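(* Let $(\mathfrak g,\lhd,\mathfrak a)$ be a right Lie module over a field of characteristic zero and let $\mathbf T\colon\mathcal U(\mathfrak g)\to\mathcal U(\mathfrak a)$ be a Hopf $\mathcal O$-operator on the right Hopf module $(\mathcal U(\mathfrak g),\lhd,\mathcal U(\mathfrak a))$. Then $\mathbf T$ is invertible for the product $\#$, and its inverse for $\#$ is $$\mathbf T^{-1^{\#}}=\mathbf T\circ\mathcal S_{\mathcal U(\mathfrak g)} .$$
   Context: A right Lie module $(\mathfrak g,\lhd,\mathfrak a)$: Lie algebras $\mathfrak g,\mathfrak a$ and a bilinear map $\lhd\colon\mathfrak g\times\mathfrak a\to\mathfrak g$ with $[x,y]\lhd a=[x\lhd a,y]+[x,y\lhd a]$ and $x\lhd[a,b]=(x\lhd a)\lhd b-(x\lhd b)\lhd a$. The action extends uniquely to a right action $\lhd$ of the algebra $\mathcal U(\mathfrak a)$ on $\mathcal U(\mathfrak g)$ such that each $a\in\mathfrak a$ acts by the derivation extending $x\mapsto x\lhd a$; then $(XY)\lhd A=(X\lhd A_{(1)})(Y\lhd A_{(2)})$ and $\lhd$ is a coalgebra map. Enveloping algebras carry their standard cocommutative Hopf structure; $\varepsilon,\eta,\mathcal S$ are counit, unit, antipode; Sweedler notation is used. A Hopf $\mathcal O$-operator is a coalgebra map $\mathbf T\colon\mathcal U(\mathfrak g)\to\mathcal U(\mathfrak a)$ (preserving counits) with $\mathbf T(e)\mathbf T(f)=\mathbf T\big((e\lhd\mathbf T(f_{(1)}))f_{(2)}\big)$ for all $e,f$. For linear maps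 $A,B\colon\mathcal U(\mathfrak g)\to\mathcal U(\mathfrak a)$, $(A\#B)(f)=A\big(f_{(1)}\lhd\mathcal S_{\mathcal U(\mathfrak a)}(B(f_{(2)})_{(1)})\big)\,B(f_{(2)})_{(2)}$; this is an associative product with unit $\eta_{\mathcal U(\mathfrak a)}\circ\varepsilon_{\mathcal U(\mathfrak g)}$. *)

(* Defs.v *)
From HB Require Import structures.
From mathcomp Require Import all_boot all_order all_algebra.
From mathcomp Require Import boolp.

Set Implicit Arguments.
Unset Strict Implicit.
Unset Printing Implicit Defensive.

Import GRing.Theory.
Local Open Scope ring_scope.
Local Open Scope quotient_scope.

HB.mixin Record isLieAlgebra (K : fieldType) V of GRing.Lmodule K V := {
  lie : V -> V -> V;
  lieDl : forall x y z, lie (x + y) z = lie x z + lie y z;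
  lieDr : forall x y z, lie x (y + z) = lie x y + lie x z;
  lieZl : forall (c : K) x y, lie (c *: x) y = c *: lie x y;
  lieZr : forall (c : K) x y, lie x (c *: y) = c *: lie x y;
  liexx : forall x, lie x x = 0;
  lie_jacobi : forall x y z,
    lie x (lie y z) + lie y (lie z x) + lie z (lie x y) = 0
}.

#[short(type="lieAlgType")]
HB.structure Definition LieAlgebra (K : fieldType) :=
  {V of isLieAlgebra K V & GRing.Lmodule K V}.

Record rLieModule (K : fieldType) (g a : lieAlgType K) := RLieModule {
  mact :> g -> a -> g;
  mactDl : forall x y u, mact (x + y) u = mact x u + mact y u;
  mactDr : forall x u v, mact x (u + v) = mact x u + mact x v;
  mactZl : forall (c : K) x u, mact (c *: x) u = c *: mact x u;
  mactZr : forall (c : K) x u, mact x (c *: u) = c *: mact x u;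
  mact_der : forall x y u,
    mact (lie x y) u = lie (mact x u) y + lie x (mact y u);
  mact_lie : forall x u v,
    mact x (lie u v) = mact (mact x u) v - mact (mact x v) u
}.

(* Formal linear combinations of symbols v (x) w, modulo the vector space
   axioms and bilinearity of (x). *)
Section TensorTerms.
Variables (K : fieldType) (V W : lmodType K).

Inductive tterm :=
  | TZero
  | TPure of V & W
  | TAdd of tterm & tterm
  | TScale of K & tterm.

Inductive trel : tterm -> tterm -> Prop :=
  | trel_refl s : trel s s
  | trel_sym s t : trel s t -> trel t s
  | trel_trans s t r : trel s t -> trel t r -> trel s r
  | trel_add s s' t t' :
      trel s s' -> trel t t' -> trel (TAdd s t) (TAdd s' t')
  | trel_scale c s s' : trel s s' -> trel (TScale c s) (TScale c s')
  | trel_addA s t r : trel (TAdd s (TAdd t r)) (TAdd (TAdd s t) r)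
  | trel_addC s t : trel (TAdd s t) (TAdd t s)
  | trel_add0 s : trel (TAdd TZero s) s
  | trel_addN s : trel (TAdd (TScale (-1) s) s) TZero
  | trel_scaleA c d s : trel (TScale c (TScale d s)) (TScale (c * d) s)
  | trel_scale1 s : trel (TScale 1 s) s
  | trel_scaleDr c s t :
      trel (TScale c (TAdd s t)) (TAdd (TScale c s) (TScale c t))
  | trel_scaleDl c d s :
      trel (TScale (c + d) s) (TAdd (TScale c s) (TScale d s))
  | trel_pureDl v v' w : trel (TPure (v + v') w) (TAdd (TPure v w) (TPure v' w))
  | trel_pureDr v w w' : trel (TPure v (w + w')) (TAdd (TPure v w) (TPure v w'))
  | trel_pureZl c v w : trel (TPure (c *: v) w) (TScale c (TPure v w))
  | trel_pureZr c v w : trel (TPure v (c *: w)) (TScale c (TPure v w)).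

HB.instance Definition _ := gen_eqMixin tterm.
HB.instance Definition _ := gen_choiceMixin tterm.

Definition trelb (s t : tterm) : bool := `[< trel s t >].

Lemma trelb_refl : reflexive trelb.
Proof. by move=> s; apply/asboolP; apply: trel_refl. Qed.

Lemma trelb_sym : symmetric trelb.
Proof.
by move=> s t; apply/asboolP/asboolP; apply: trel_sym.
Qed.

Lemma trelb_trans : transitive trelb.
Proof.
by move=> t s r /asboolP st /asboolP tr; apply/asboolP; apply: trel_trans tr.
Qed.

Canonical trel_equiv := EquivRel trelb trelb_refl trelb_sym trelb_trans.

Definition tensor := {eq_quot trel_equiv}.
HB.instance Definition _ := Choice.on tensor.

Definition tpi (s : tterm) : tensor := \pi_{eq_quot trel_equiv} s.
Definition trepr (s : tensor) : tterm := repr (s : {eq_quot trel_equiv}).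

Lemma treprK (s : tensor) : tpi (trepr s) = s.
Proof. exact: reprK. Qed.

Lemma tensor_piP (s t : tterm) : tpi s = tpi t <-> trel s t.
Proof. by split => [/eqmodP/asboolP | st] //; apply/eqmodP/asboolP. Qed.

Lemma trel_repr (s : tterm) : trel (trepr (tpi s)) s.
Proof. by apply/tensor_piP; rewrite treprK. Qed.

Definition tzero : tensor := tpi TZero.
Definition tadd (s t : tensor) : tensor := tpi (TAdd (trepr s) (trepr t)).
Definition tscale (c : K) (s : tensor) : tensor := tpi (TScale c (trepr s)).
Definition tens (v : V) (w : W) : tensor := tpi (TPure v w).

Lemma tadd_pi s t : tadd (tpi s) (tpi t) = tpi (TAdd s t).
Proof. by apply/tensor_piP; apply: trel_add; apply: trel_repr. Qed.

Lemma tscale_pi c s : tscale c (tpi s) = tpi (TScale c s).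
Proof. by apply/tensor_piP; apply: trel_scale; apply: trel_repr. Qed.

Lemma tensor_piW (P : tensor -> Prop) :
  (forall s, P (tpi s)) -> forall s, P s.
Proof. by move=> Ps s; rewrite -(treprK s). Qed.

Fact taddA : associative tadd.
Proof.
elim/tensor_piW => s; elim/tensor_piW => t; elim/tensor_piW => r.
by rewrite !tadd_pi; apply/tensor_piP; apply: trel_addA.
Qed.

Fact taddC : commutative tadd.
Proof.
elim/tensor_piW => s; elim/tensor_piW => t.
by rewrite !tadd_pi; apply/tensor_piP; apply: trel_addC.
Qed.

Fact tadd0 : left_id tzero tadd.
Proof.
elim/tensor_piW => s.
by rewrite tadd_pi; apply/tensor_piP; apply: trel_add0.
Qed.

Fact taddN : left_inverse tzero (tscale (-1)) tadd.
Proof.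
elim/tensor_piW => s.
by rewrite tscale_pi tadd_pi; apply/tensor_piP; apply: trel_addN.
Qed.

HB.instance Definition _ := GRing.isZmodule.Build tensor taddA taddC tadd0 taddN.

Fact tscaleA c d (s : tensor) : tscale c (tscale d s) = tscale (c * d) s.
Proof.
elim/tensor_piW: s => s.
by rewrite !tscale_pi; apply/tensor_piP; apply: trel_scaleA.
Qed.

Fact tscale1 : left_id 1 tscale.
Proof.
by elim/tensor_piW => s; rewrite tscale_pi; apply/tensor_piP; apply: trel_scale1.
Qed.

Fact tscaleDr : right_distributive tscale +%R.
Proof.
move=> c; elim/tensor_piW => s; elim/tensor_piW => t.
change (tscale c (tadd (tpi s) (tpi t)) =
  tadd (tscale c (tpi s)) (tscale c (tpi t))).
rewrite tadd_pi !tscale_pi tadd_pi.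
by apply/tensor_piP; apply: trel_scaleDr.
Qed.

Fact tscaleDl (s : tensor) : {morph tscale^~ s : c d / c + d}.
Proof.
move=> c d; elim/tensor_piW: s => s.
change (tscale (c + d) (tpi s) = tadd (tscale c (tpi s)) (tscale d (tpi s))).
rewrite !tscale_pi tadd_pi.
by apply/tensor_piP; apply: trel_scaleDl.
Qed.

HB.instance Definition _ := GRing.Zmodule_isLmodule.Build K tensor
  tscaleA tscale1 tscaleDr tscaleDl.

Lemma tensDl v v' w : tens (v + v') w = tens v w + tens v' w.
Proof.
by rewrite [RHS]tadd_pi; apply/tensor_piP; apply: trel_pureDl.
Qed.

Lemma tensDr v w w' : tens v (w + w') = tens v w + tens v w'.
Proof.
by rewrite [RHS]tadd_pi; apply/tensor_piP; apply: trel_pureDr.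
Qed.

Lemma tensZl c v w : tens (c *: v) w = c *: tens v w.
Proof.
by rewrite [RHS]tscale_pi; apply/tensor_piP; apply: trel_pureZl.
Qed.

Lemma tensZr c v w : tens v (c *: w) = c *: tens v w.
Proof.
by rewrite [RHS]tscale_pi; apply/tensor_piP; apply: trel_pureZr.
Qed.

Lemma tensor_ind (P : tensor -> Prop) :
  P 0 -> (forall v w, P (tens v w)) ->
  (forall s t, P s -> P t -> P (s + t)) ->
  (forall c s, P s -> P (c *: s)) -> forall s, P s.
Proof.
move=> P0 Pp PD PZ; elim/tensor_piW; elim => [|v w|s Ps t Pt|c s Ps].
- exact: P0.
- exact: Pp.
- by rewrite -tadd_pi; apply: PD.
- by rewrite -tscale_pi; apply: PZ.
Qed.

End TensorTerms.

Notation "v *t w" := (tens v w) (at level 40, left associativity) : ring_scope.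

Section TensorLift.
Variables (K : fieldType) (V W Z : lmodType K).

Record bilinear_map (beta : V -> W -> Z) : Prop := BilinearMap {
  bilinDl : forall v v' w, beta (v + v') w = beta v w + beta v' w;
  bilinDr : forall v w w', beta v (w + w') = beta v w + beta v w';
  bilinZl : forall c v w, beta (c *: v) w = c *: beta v w;
  bilinZr : forall c v w, beta v (c *: w) = c *: beta v w
}.

Fixpoint teval (beta : V -> W -> Z) (s : tterm V W) : Z :=
  match s with
  | TZero => 0
  | TPure v w => beta v w
  | TAdd s t => teval beta s + teval beta t
  | TScale c s => c *: teval beta s
  end.

(* The linear map induced by [beta]; meaningful for bilinear [beta] only. *)
Definition tlift (beta : V -> W -> Z) (s : tensor V W) : Z :=
  teval beta (trepr s).

Lemma teval_rel beta s t : bilinear_map beta ->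
  trel s t -> teval beta s = teval beta t.
Proof.
move=> [bDl bDr bZl bZr]; elim=> {s t} //=.
- by move=> s t r _ -> _ ->.
- by move=> s s' t t' _ -> _ ->.
- by move=> c s s' _ ->.
- by move=> s t r; rewrite addrA.
- by move=> s t; rewrite addrC.
- by move=> s; rewrite add0r.
- by move=> s; rewrite scaleN1r addNr.
- by move=> c d s; rewrite scalerA.
- by move=> s; rewrite scale1r.
- by move=> c s t; rewrite scalerDr.
- by move=> c d s; rewrite scalerDl.
Qed.

Section Bilinear.
Variables (beta : V -> W -> Z) (bil : bilinear_map beta).

Lemma tlift_pi s : tlift beta (tpi s) = teval beta s.
Proof. by apply: teval_rel => //; apply: trel_repr. Qed.

Lemma tlift_tens v w : tlift beta (v *t w) = beta v w.
Proof. exact: tlift_pi. Qed.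

Lemma tliftD s t : tlift beta (s + t) = tlift beta s + tlift beta t.
Proof.
elim/tensor_piW: s => s; elim/tensor_piW: t => t.
by rewrite [X in tlift _ X]tadd_pi !tlift_pi.
Qed.

Lemma tliftZ c s : tlift beta (c *: s) = c *: tlift beta s.
Proof.
by elim/tensor_piW: s => s; rewrite [X in tlift _ X]tscale_pi !tlift_pi.
Qed.

Lemma tlift0 : tlift beta 0 = 0.
Proof. by rewrite -[0 in LHS](scale0r 0) tliftZ scale0r. Qed.

End Bilinear.

Lemma tlift_add (b b' : V -> W -> Z) s :
  tlift (fun v w => b v w + b' v w) s = tlift b s + tlift b' s.
Proof.
rewrite /tlift; elim: (trepr s) => [|v w|t IHt r IHr|c t IHt] //=.
- by rewrite addr0.
- by rewrite IHt IHr addrACA.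
- by rewrite IHt scalerDr.
Qed.

Lemma tlift_scale c (b : V -> W -> Z) s :
  tlift (fun v w => c *: b v w) s = c *: tlift b s.
Proof.
rewrite /tlift; elim: (trepr s) => [|v w|t IHt r IHr|d t IHt] //=.
- by rewrite scaler0.
- by rewrite IHt IHr scalerDr.
- by rewrite IHt !scalerA mulrC.
Qed.

Lemma eq_tlift (b b' : V -> W -> Z) :
  (forall v w, b v w = b' v w) -> tlift b =1 tlift b'.
Proof.
move=> E s; rewrite /tlift.
by elim: (trepr s) => [|v w|t IHt r IHr|d t IHt] //=; rewrite ?IHt ?IHr ?E.
Qed.

End TensorLift.

Section TensorAlgebra.
Variables (K : fieldType) (A B : algType K).
Local Notation AB := (tensor A B).

Definition tmul (s t : AB) : AB :=
  tlift (fun u v => tlift (fun u' v' => (u * u') *t (v * v')) t) s.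

Lemma tmul_bilin_in (u : A) (v : B) :
  bilinear_map (fun u' v' => (u * u') *t (v * v')).
Proof.
split=> *; rewrite ?mulrDr ?tensDl ?tensDr //.
- by rewrite -scalerAr tensZl.
- by rewrite -scalerAr tensZr.
Qed.

Lemma tmul_bilin_out (t : AB) :
  bilinear_map (fun u v => tlift (fun u' v' => (u * u') *t (v * v')) t).
Proof.
split=> [u u' v|u v v'|c u v|c u v].
- by rewrite -tlift_add; apply: eq_tlift => * /=; rewrite mulrDl tensDl.
- by rewrite -tlift_add; apply: eq_tlift => * /=; rewrite mulrDl tensDr.
- by rewrite -tlift_scale; apply: eq_tlift => * /=; rewrite -scalerAl tensZl.
- by rewrite -tlift_scale; apply: eq_tlift => * /=; rewrite -scalerAl tensZr.
Qed.

Lemma tmul_tens u v u' v' : tmul (u *t v) (u' *t v') = (u * u') *t (v * v').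
Proof.
rewrite /tmul tlift_tens; last exact: tmul_bilin_out.
by rewrite tlift_tens //; apply: tmul_bilin_in.
Qed.

Lemma tmulDl : left_distributive tmul +%R.
Proof. by move=> s s' t; apply: tliftD; apply: tmul_bilin_out. Qed.

Lemma tmulZl c s t : tmul (c *: s) t = c *: tmul s t.
Proof. by apply: tliftZ; apply: tmul_bilin_out. Qed.

Lemma tmulDr : right_distributive tmul +%R.
Proof.
move=> s t t'; rewrite /tmul -tlift_add; apply: eq_tlift => u v.
by rewrite tliftD //; apply: tmul_bilin_in.
Qed.

Lemma tmulZr c s t : tmul s (c *: t) = c *: tmul s t.
Proof.
rewrite /tmul -tlift_scale; apply: eq_tlift => u v.
by rewrite tliftZ //; apply: tmul_bilin_in.
Qed.

Lemma tmul0l t : tmul 0 t = 0.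
Proof. by rewrite -[0 in LHS](scale0r 0) tmulZl scale0r. Qed.

Lemma tmul0r s : tmul s 0 = 0.
Proof. by rewrite -[0 in LHS](scale0r 0) tmulZr scale0r. Qed.

Lemma tmulA : associative tmul.
Proof.
elim/tensor_ind => [|u v|s s' IH IH'|c s IH] t r.
- by rewrite !tmul0l.
- elim/tensor_ind: t => [|u' v'|t t' IH IH'|c t IH].
  + by rewrite !(tmul0l, tmul0r).
  + elim/tensor_ind: r => [|u'' v''|r r' IH IH'|c r IH].
    * by rewrite !tmul0r.
    * by rewrite !tmul_tens !mulrA.
    * by rewrite !tmulDr IH IH'.
    * by rewrite !tmulZr IH.
  + by rewrite !(tmulDr, tmulDl) IH IH'.
  + by rewrite !(tmulZr, tmulZl) IH.
- by rewrite !tmulDl IH IH'.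
- by rewrite !tmulZl IH.
Qed.

Lemma tmul1l : left_id (1 *t 1) tmul.
Proof.
elim/tensor_ind => [|u v|s s' IH IH'|c s IH].
- by rewrite tmul0r.
- by rewrite tmul_tens !mul1r.
- by rewrite tmulDr IH IH'.
- by rewrite tmulZr IH.
Qed.

Lemma tmul1r : right_id (1 *t 1) tmul.
Proof.
elim/tensor_ind => [|u v|s s' IH IH'|c s IH].
- by rewrite tmul0l.
- by rewrite tmul_tens !mulr1.
- by rewrite tmulDl IH IH'.
- by rewrite tmulZl IH.
Qed.

HB.instance Definition _ := GRing.Zmodule_isPzRing.Build AB
  tmulA tmul1l tmul1r tmulDl tmulDr.

Lemma tensM (u u' : A) (v v' : B) :
  (u *t v) * (u' *t v') = (u * u') *t (v * v') :> AB.
Proof. exact: tmul_tens. Qed.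

End TensorAlgebra.

(* U(g) is the associative unital algebra generated by the symbols uiota x,
   x in g, subject to the linearity of uiota and to
   uiota [x, y] = uiota x uiota y - uiota y uiota x; [EScal c] stands for c 1. *)
Section EnvTerms.
Variables (K : fieldType) (g : lieAlgType K).

Inductive eterm :=
  | EGen of g
  | EScal of K
  | EAdd of eterm & eterm
  | EMul of eterm & eterm.

Inductive erel : eterm -> eterm -> Prop :=
  | erel_refl s : erel s s
  | erel_sym s t : erel s t -> erel t s
  | erel_trans s t r : erel s t -> erel t r -> erel s r
  | erel_add s s' t t' :
      erel s s' -> erel t t' -> erel (EAdd s t) (EAdd s' t')
  | erel_mul s s' t t' :
      erel s s' -> erel t t' -> erel (EMul s t) (EMul s' t')
  | erel_addA s t r : erel (EAdd s (EAdd t r)) (EAdd (EAdd s t) r)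
  | erel_addC s t : erel (EAdd s t) (EAdd t s)
  | erel_add0 s : erel (EAdd (EScal 0) s) s
  | erel_addN s : erel (EAdd (EMul (EScal (-1)) s) s) (EScal 0)
  | erel_mulA s t r : erel (EMul s (EMul t r)) (EMul (EMul s t) r)
  | erel_mul1l s : erel (EMul (EScal 1) s) s
  | erel_mul1r s : erel (EMul s (EScal 1)) s
  | erel_mulDl s t r : erel (EMul (EAdd s t) r) (EAdd (EMul s r) (EMul t r))
  | erel_mulDr s t r : erel (EMul s (EAdd t r)) (EAdd (EMul s t) (EMul s r))
  | erel_scalD c d : erel (EScal (c + d)) (EAdd (EScal c) (EScal d))
  | erel_scalM c d : erel (EScal (c * d)) (EMul (EScal c) (EScal d))
  | erel_scalC c s : erel (EMul (EScal c) s) (EMul s (EScal c))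
  | erel_genD x y : erel (EGen (x + y)) (EAdd (EGen x) (EGen y))
  | erel_genZ c x : erel (EGen (c *: x)) (EMul (EScal c) (EGen x))
  | erel_lie x y :
      erel (EGen (lie x y))
           (EAdd (EMul (EGen x) (EGen y))
                 (EMul (EScal (-1)) (EMul (EGen y) (EGen x)))).

HB.instance Definition _ := gen_eqMixin eterm.
HB.instance Definition _ := gen_choiceMixin eterm.

Definition erelb (s t : eterm) : bool := `[< erel s t >].

Lemma erelb_refl : reflexive erelb.
Proof. by move=> s; apply/asboolP; apply: erel_refl. Qed.

Lemma erelb_sym : symmetric erelb.
Proof.
by move=> s t; apply/asboolP/asboolP; apply: erel_sym.
Qed.

Lemma erelb_trans : transitive erelb.
Proof.
by move=> t s r /asboolP st /asboolP tr; apply/asboolP; apply: erel_trans tr.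
Qed.

Canonical erel_equiv := EquivRel erelb erelb_refl erelb_sym erelb_trans.

Definition env := {eq_quot erel_equiv}.
HB.instance Definition _ := Choice.on env.

Definition epi (s : eterm) : env := \pi_{eq_quot erel_equiv} s.
Definition erepr (s : env) : eterm := repr (s : {eq_quot erel_equiv}).

Lemma ereprK (s : env) : epi (erepr s) = s.
Proof. exact: reprK. Qed.

Lemma env_piP (s t : eterm) : epi s = epi t <-> erel s t.
Proof. by split => [/eqmodP/asboolP | st] //; apply/eqmodP/asboolP. Qed.

Lemma erel_repr (s : eterm) : erel (erepr (epi s)) s.
Proof. by apply/env_piP; rewrite ereprK. Qed.

Lemma env_piW (P : env -> Prop) : (forall s, P (epi s)) -> forall s, P s.
Proof. by move=> Ps s; rewrite -(ereprK s). Qed.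

Definition escal (c : K) : env := epi (EScal c).
Definition eadd (s t : env) : env := epi (EAdd (erepr s) (erepr t)).
Definition emul (s t : env) : env := epi (EMul (erepr s) (erepr t)).
Definition escale (c : K) (s : env) : env := emul (escal c) s.
Definition uiota (x : g) : env := epi (EGen x).

Lemma eadd_pi s t : eadd (epi s) (epi t) = epi (EAdd s t).
Proof. by apply/env_piP; apply: erel_add; apply: erel_repr. Qed.

Lemma emul_pi s t : emul (epi s) (epi t) = epi (EMul s t).
Proof. by apply/env_piP; apply: erel_mul; apply: erel_repr. Qed.

Fact eaddA : associative eadd.
Proof.
elim/env_piW => s; elim/env_piW => t; elim/env_piW => r.
by rewrite !eadd_pi; apply/env_piP; apply: erel_addA.
Qed.

Fact eaddC : commutative eadd.
Proof.
elim/env_piW => s; elim/env_piW => t.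
by rewrite !eadd_pi; apply/env_piP; apply: erel_addC.
Qed.

Fact eadd0 : left_id (escal 0) eadd.
Proof.
by elim/env_piW => s; rewrite eadd_pi; apply/env_piP; apply: erel_add0.
Qed.

Fact eaddN : left_inverse (escal 0) (escale (-1)) eadd.
Proof.
elim/env_piW => s.
by rewrite /escale emul_pi eadd_pi; apply/env_piP; apply: erel_addN.
Qed.

HB.instance Definition _ := GRing.isZmodule.Build env eaddA eaddC eadd0 eaddN.

Fact emulA : associative emul.
Proof.
elim/env_piW => s; elim/env_piW => t; elim/env_piW => r.
by rewrite !emul_pi; apply/env_piP; apply: erel_mulA.
Qed.

Fact emul1l : left_id (escal 1) emul.
Proof.
by elim/env_piW => s; rewrite emul_pi; apply/env_piP; apply: erel_mul1l.
Qed.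

Fact emul1r : right_id (escal 1) emul.
Proof.
by elim/env_piW => s; rewrite emul_pi; apply/env_piP; apply: erel_mul1r.
Qed.

Fact emulDl : left_distributive emul eadd.
Proof.
elim/env_piW => s; elim/env_piW => t; elim/env_piW => r.
by rewrite !(emul_pi, eadd_pi); apply/env_piP; apply: erel_mulDl.
Qed.

Fact emulDr : right_distributive emul eadd.
Proof.
elim/env_piW => s; elim/env_piW => t; elim/env_piW => r.
by rewrite !(emul_pi, eadd_pi); apply/env_piP; apply: erel_mulDr.
Qed.

Fixpoint eeval (A : algType K) (f : g -> A) (s : eterm) : A :=
  match s with
  | EGen x => f x
  | EScal c => c%:A
  | EAdd s t => eeval f s + eeval f t
  | EMul s t => eeval f s * eeval f t
  end.

Record lie_morphism (A : algType K) (f : g -> A) : Prop := LieMorphism {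
  lie_morphD : forall x y, f (x + y) = f x + f y;
  lie_morphZ : forall c x, f (c *: x) = c *: f x;
  lie_morphB : forall x y, f (lie x y) = f x * f y - f y * f x
}.

Lemma eeval_rel (A : algType K) (f : g -> A) s t :
  lie_morphism f -> erel s t -> eeval f s = eeval f t.
Proof.
move=> [fD fZ fB]; elim=> {s t} //=.
- by move=> s t r _ -> _ ->.
- by move=> s s' t t' _ -> _ ->.
- by move=> s s' t t' _ -> _ ->.
- by move=> s t r; rewrite addrA.
- by move=> s t; rewrite addrC.
- by move=> s; rewrite scale0r add0r.
- by move=> s; rewrite scaleN1r mulN1r addNr scale0r.
- by move=> s t r; rewrite mulrA.
- by move=> s; rewrite scale1r mul1r.
- by move=> s; rewrite scale1r mulr1.
- by move=> s t r; rewrite mulrDl.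
- by move=> s t r; rewrite mulrDr.
- by move=> c d; rewrite scalerDl.
- by move=> c d; rewrite -scalerAl mul1r scalerA.
- by move=> c s; rewrite -scalerAl mul1r -scalerAr mulr1.
- by move=> c x; rewrite fZ -scalerAl mul1r.
- by move=> x y; rewrite fB scaleN1r mulN1r.
Qed.

Lemma lie_morphism0 : lie_morphism (fun _ : g => 0 : K^o).
Proof.
by split=> *; rewrite ?addr0 ?scaler0 ?mulr0 ?subr0.
Qed.

Fact env1_neq0 : escal 1 != escal 0.
Proof.
apply/eqP => /env_piP /(eeval_rel lie_morphism0) /= /eqP.
by rewrite scale1r scale0r oner_eq0.
Qed.

HB.instance Definition _ := GRing.Zmodule_isNzRing.Build env
  emulA emul1l emul1r emulDl emulDr env1_neq0.

Fact escaleA c d (s : env) : escale c (escale d s) = escale (c * d) s.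
Proof.
rewrite /escale emulA emul_pi; congr emul.
by apply/env_piP; apply: erel_sym; apply: erel_scalM.
Qed.

Fact escale1 : left_id 1 escale.
Proof. exact: emul1l. Qed.

Fact escaleDr : right_distributive escale +%R.
Proof. by move=> c s t; apply: emulDr. Qed.

Fact escaleDl (s : env) : {morph escale^~ s : c d / c + d}.
Proof.
move=> c d; rewrite /escale.
suff -> : escal (c + d) = eadd (escal c) (escal d) by apply: emulDl.
by rewrite eadd_pi; apply/env_piP; apply: erel_scalD.
Qed.

HB.instance Definition _ := GRing.Zmodule_isLmodule.Build K env
  escaleA escale1 escaleDr escaleDl.

Fact escaleAl c (s t : env) : c *: (s * t) = (c *: s) * t.
Proof. exact: emulA. Qed.

HB.instance Definition _ := GRing.Lmodule_isLalgebra.Build K env escaleAl.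

Fact escaleAr c (s t : env) : c *: (s * t) = s * (c *: t).
Proof.
change (emul (escal c) (emul s t) = emul s (emul (escal c) t)).
rewrite !emulA; congr emul; elim/env_piW: s => s.
by rewrite !emul_pi; apply/env_piP; apply: erel_scalC.
Qed.

HB.instance Definition _ := GRing.Lalgebra_isAlgebra.Build K env escaleAr.

Lemma epiD s t : epi (EAdd s t) = epi s + epi t.
Proof. by rewrite -eadd_pi. Qed.

Lemma epiM s t : epi (EMul s t) = epi s * epi t.
Proof. by rewrite -emul_pi. Qed.

Lemma epi_scal c : epi (EScal c) = c%:A.
Proof. by rewrite -[LHS]mulr1. Qed.

Lemma uiota_lie_morphism : lie_morphism uiota.
Proof.
split=> [x y|c x|x y].
- by rewrite -epiD; apply/env_piP; apply: erel_genD.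
- rewrite -[RHS]/(escale c (uiota x)) [RHS]emul_pi.
  by apply/env_piP; apply: erel_genZ.
- rewrite -mulN1r -scaleN1r -epi_scal /uiota.
  rewrite -(epiM (EGen x)) -(epiM (EGen y)) -epiM -epiD.
  by apply/env_piP; apply: erel_lie.
Qed.

Lemma env_ind (P : env -> Prop) :
  (forall x, P (uiota x)) -> (forall c, P c%:A) ->
  (forall s t, P s -> P t -> P (s + t)) ->
  (forall s t, P s -> P t -> P (s * t)) -> forall s, P s.
Proof.
move=> Pi P1 PD PM; elim/env_piW; elim=> [x|c|s Ps t Pt|s Ps t Pt].
- exact: Pi.
- by rewrite epi_scal; apply: P1.
- by rewrite epiD; apply: PD.
- by rewrite epiM; apply: PM.
Qed.

(* The algebra morphism extending [f]; meaningful when [lie_morphism f]. *)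
Definition env_lift (A : algType K) (f : g -> A) (s : env) : A :=
  eeval f (erepr s).

Section Lift.
Variables (A : algType K) (f : g -> A) (fL : lie_morphism f).

Lemma env_lift_pi s : env_lift f (epi s) = eeval f s.
Proof. by apply: eeval_rel => //; apply: erel_repr. Qed.

Lemma env_lift_iota x : env_lift f (uiota x) = f x.
Proof. exact: env_lift_pi. Qed.

Lemma env_liftD s t : env_lift f (s + t) = env_lift f s + env_lift f t.
Proof.
elim/env_piW: s => s; elim/env_piW: t => t.
by rewrite -epiD !env_lift_pi.
Qed.

Lemma env_liftM s t : env_lift f (s * t) = env_lift f s * env_lift f t.
Proof.
elim/env_piW: s => s; elim/env_piW: t => t.
by rewrite -epiM !env_lift_pi.
Qed.

Lemma env_lift_scal c : env_lift f c%:A = c%:A.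
Proof. by rewrite -epi_scal env_lift_pi. Qed.

Lemma env_lift1 : env_lift f 1 = 1.
Proof. by rewrite -[1 in LHS]scale1r env_lift_scal scale1r. Qed.

Lemma env_liftZ c s : env_lift f (c *: s) = c *: env_lift f s.
Proof.
by rewrite -[in LHS](mul1r s) scalerAl env_liftM env_lift_scal -scalerAl mul1r.
Qed.

Lemma env_lift_uniq (h : env -> A) :
  (forall x, h (uiota x) = f x) -> (forall c, h c%:A = c%:A) ->
  (forall s t, h (s + t) = h s + h t) ->
  (forall s t, h (s * t) = h s * h t) -> h =1 env_lift f.
Proof.
move=> hi h1 hD hM; elim/env_ind => [x|c|s t IH IH'|s t IH IH'].
- by rewrite hi env_lift_iota.
- by rewrite h1 env_lift_scal.
- by rewrite hD env_liftD IH IH'.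
- by rewrite hM env_liftM IH IH'.
Qed.

End Lift.

End EnvTerms.

Section Counit.
Variables (K : fieldType) (g : lieAlgType K).
Local Notation U := (env g).

Definition counit (f : U) : K := env_lift (fun _ : g => 0 : K^o) f.

Lemma counit_iota (x : g) : counit (uiota x) = 0.
Proof. exact: (env_lift_iota (lie_morphism0 g)). Qed.

Lemma counitD (s t : U) : counit (s + t) = counit s + counit t.
Proof. exact: (env_liftD (lie_morphism0 g)). Qed.

Lemma counitZ c (s : U) : counit (c *: s) = c * counit s.
Proof. exact: (env_liftZ (lie_morphism0 g)). Qed.

Lemma counitM (s t : U) : counit (s * t) = counit s * counit t.
Proof. exact: (env_liftM (lie_morphism0 g)). Qed.

Lemma counit1 : counit 1 = 1.
Proof. exact: (env_lift1 (lie_morphism0 g)). Qed.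

Lemma tens_env_neq0 : (1 : U) *t (1 : U) != 0.
Proof.
have bil : bilinear_map (fun s t : U => counit s * counit t : K^o).
  split=> *; rewrite ?counitD ?mulrDl ?mulrDr ?counitZ //.
  - by rewrite -mulrA.
  - by rewrite mulrCA.
apply/eqP => /(congr1 (tlift (fun s t : U => counit s * counit t : K^o))).
rewrite (tlift_tens bil) (tlift0 bil) counit1 mulr1 => /eqP.
by rewrite oner_eq0.
Qed.

HB.instance Definition _ :=
  GRing.PzSemiRing_isNonZero.Build (tensor U U) tens_env_neq0.

Fact tens_env_scaleAl c (s t : tensor U U) : c *: (s * t) = (c *: s) * t.
Proof. by rewrite [RHS]tmulZl. Qed.

HB.instance Definition _ :=
  GRing.Lmodule_isLalgebra.Build K (tensor U U) tens_env_scaleAl.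

Fact tens_env_scaleAr c (s t : tensor U U) : c *: (s * t) = s * (c *: t).
Proof. by rewrite [RHS]tmulZr. Qed.

HB.instance Definition _ :=
  GRing.Lalgebra_isAlgebra.Build K (tensor U U) tens_env_scaleAr.

Definition coprod (f : U) : tensor U U :=
  env_lift (fun x : g => uiota x *t (1 : U) + (1 : U) *t uiota x) f.

Lemma coprod_lie_morphism :
  lie_morphism (fun x : g => uiota x *t (1 : U) + (1 : U) *t uiota x).
Proof.
have [iD iZ iB] := uiota_lie_morphism g.
split=> [x y|c x|x y].
- by rewrite iD tensDl tensDr addrACA.
- by rewrite iZ tensZl tensZr scalerDr.
- rewrite iB !mulrDl !mulrDr !tensM !mul1r !mulr1.
  rewrite tensDl tensDr -!scaleN1r tensZl tensZr !scaleN1r !opprD.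
  set p := (uiota x * uiota y) *t 1; set q := 1 *t (uiota x * uiota y).
  set p' := (uiota y * uiota x) *t 1; set q' := 1 *t (uiota y * uiota x).
  set u := uiota x *t uiota y; set v := uiota y *t uiota x.
  rewrite [- p' - v + _]addrACA [RHS]addrACA [p + u + _]addrACA.
  by rewrite [v + q + _]addrACA !subrr addr0 add0r.
Qed.

Lemma coprod_iota (x : g) : coprod (uiota x) = uiota x *t 1 + 1 *t uiota x.
Proof. exact: (env_lift_iota coprod_lie_morphism). Qed.

Lemma coprodD (s t : U) : coprod (s + t) = coprod s + coprod t.
Proof. exact: (env_liftD coprod_lie_morphism). Qed.

Lemma coprodZ c (s : U) : coprod (c *: s) = c *: coprod s.
Proof. exact: (env_liftZ coprod_lie_morphism). Qed.

Lemma coprodM (s t : U) : coprod (s * t) = coprod s * coprod t.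
Proof. exact: (env_liftM coprod_lie_morphism). Qed.

Lemma coprod1 : coprod 1 = 1 *t 1.
Proof. exact: (env_lift1 coprod_lie_morphism). Qed.

End Counit.

(* Sweedler notation: [sweedler f (fun f1 f2 => E)] is E(f_(1), f_(2)), that is,
   the linear map induced by the bilinear expression E, evaluated at the
   coproduct of f. *)
Definition sweedler (K : fieldType) (g : lieAlgType K) (Z : lmodType K)
    (f : env g) (E : env g -> env g -> Z) : Z := tlift E (coprod f).

Lemma sweedler_linear (K : fieldType) (g : lieAlgType K) (Z : lmodType K)
    (E : env g -> env g -> Z) : bilinear_map E ->
  linear (fun f => sweedler f E).
Proof.
by move=> bE c s t; rewrite /sweedler coprodD coprodZ tliftD // tliftZ.
Qed.

Section ConverseAlgebra.
Variables (K : fieldType) (A : algType K).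

HB.instance Definition _ := GRing.Lmodule.on A^c.

Fact conv_scaleAl (c : K) (u v : A^c) : c *: (u * v) = (c *: u : A^c) * v.
Proof. exact: (@scalerAr K A c v u). Qed.
HB.instance Definition _ := GRing.Lmodule_isLalgebra.Build K A^c conv_scaleAl.

Fact conv_scaleAr (c : K) (u v : A^c) : c *: (u * v) = u * (c *: v : A^c).
Proof. exact: (@scalerAl K A c v u). Qed.
HB.instance Definition _ := GRing.Lalgebra_isAlgebra.Build K A^c conv_scaleAr.

End ConverseAlgebra.

Section Antipode.
Variables (K : fieldType) (g : lieAlgType K).
Local Notation U := (env g).

(* An algebra morphism into the opposite algebra, that is, an antimorphism. *)
Definition antipode (f : U) : U := env_lift (fun x : g => - uiota x : U^c) f.

Lemma antipode_lie_morphism : lie_morphism (fun x : g => - uiota x : U^c).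
Proof.
have [iD iZ iB] := uiota_lie_morphism g.
split=> [x y|c x|x y].
- by rewrite iD opprD.
- by rewrite iZ -scalerN.
- change (- uiota (lie x y) =
    (- uiota y) * (- uiota x) - (- uiota x) * (- uiota y) :> U).
  by rewrite !mulrNN iB opprB.
Qed.

Lemma antipode_iota x : antipode (uiota x) = - uiota x.
Proof. exact: (env_lift_iota antipode_lie_morphism). Qed.

Lemma antipodeM s t : antipode (s * t) = antipode t * antipode s.
Proof. exact: (env_liftM antipode_lie_morphism). Qed.

Lemma antipode1 : antipode 1 = 1.
Proof. exact: (env_lift1 antipode_lie_morphism). Qed.

Fact antipode_linear : linear antipode.
Proof.
move=> c s t.
rewrite /antipode (env_liftD antipode_lie_morphism).
by rewrite (env_liftZ antipode_lie_morphism).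
Qed.

HB.instance Definition _ := GRing.isLinear.Build K U U *:%R antipode
  antipode_linear.

End Antipode.

Section Action.
Variables (K : fieldType) (g a : lieAlgType K) (M : rLieModule g a).
Local Notation Ug := (env g).
Local Notation Ua := (env a).

Fixpoint ederiv (u : a) (s : eterm g) : Ug :=
  match s with
  | EGen x => uiota (M x u)
  | EScal _ => 0
  | EAdd s t => ederiv u s + ederiv u t
  | EMul s t => ederiv u s * epi t + epi s * ederiv u t
  end.

(* The derivation of U(g) extending x |-> M x u. *)
Definition uderiv (X : Ug) (u : a) : Ug := ederiv u (erepr X).

Fixpoint eact (X : Ug) (s : eterm a) : Ug :=
  match s with
  | EGen u => uderiv X u
  | EScal c => c *: X
  | EAdd s t => eact X s + eact X t
  | EMul s t => eact (eact X s) t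
  end.

Definition uact (X : Ug) (A : Ua) : Ug := eact X (erepr A).

Let iD := lie_morphD (uiota_lie_morphism g).
Let iZ := lie_morphZ (uiota_lie_morphism g).
Let iB := lie_morphB (uiota_lie_morphism g).

Lemma ederiv_rel u s t : erel s t -> ederiv u s = ederiv u t.
Proof.
elim=> {s t} //=.
- by move=> s t r _ -> _ ->.
- by move=> s s' t t' _ -> _ ->.
- move=> s s' t t' /env_piP ss' IHs /env_piP tt' IHt.
  by rewrite ss' tt' IHs IHt.
- by move=> s t r; rewrite addrA.
- by move=> s t; rewrite addrC.
- by move=> s; rewrite add0r.
- by move=> s; rewrite epi_scal scaleN1r mul0r add0r mulN1r addNr.
- by move=> s t r; rewrite !epiM mulrDl mulrDr !mulrA addrA.
- by move=> s; rewrite epi_scal scale1r mul0r mul1r add0r.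
- by move=> s; rewrite epi_scal scale1r mulr0 mulr1 addr0.
- by move=> s t r; rewrite epiD !mulrDl addrACA.
- by move=> s t r; rewrite epiD !mulrDr addrACA.
- by rewrite addr0.
- by move=> c d; rewrite mul0r mulr0 addr0.
- move=> c s; rewrite epi_scal mul0r mulr0 add0r addr0.
  by rewrite -scalerAl -scalerAr mul1r mulr1.
- by move=> x y; rewrite mactDl iD.
- by move=> c x; rewrite mactZl iZ epi_scal mul0r add0r -scalerAl mul1r.
- move=> x y; rewrite mact_der iD !iB epi_scal mul0r add0r.
  rewrite -scalerAl mul1r scaleN1r opprD addrACA.
  by rewrite [- (uiota y * _) + _]addrC.
Qed.

Lemma uderiv_pi u s : uderiv (epi s) u = ederiv u s.
Proof. by apply: ederiv_rel; apply: erel_repr. Qed.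

Lemma uderiv_iota x u : uderiv (uiota x) u = uiota (M x u).
Proof. exact: uderiv_pi. Qed.

Lemma uderivD X Y u : uderiv (X + Y) u = uderiv X u + uderiv Y u.
Proof.
elim/env_piW: X => s; elim/env_piW: Y => t.
by rewrite -epiD !uderiv_pi.
Qed.

Lemma uderivM X Y u : uderiv (X * Y) u = uderiv X u * Y + X * uderiv Y u.
Proof.
elim/env_piW: X => s; elim/env_piW: Y => t.
by rewrite -epiM !uderiv_pi.
Qed.

Lemma uderiv_scal c u : uderiv c%:A u = 0.
Proof. by rewrite -epi_scal uderiv_pi. Qed.

Lemma uderivZ c X u : uderiv (c *: X) u = c *: uderiv X u.
Proof.
by rewrite -[X in LHS]mul1r scalerAl uderivM uderiv_scal mul0r add0r
  -scalerAl mul1r.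
Qed.

Lemma uderivDr X u v : uderiv X (u + v) = uderiv X u + uderiv X v.
Proof.
elim/env_ind: X => [x|c|X Y IH IH'|X Y IH IH'].
- by rewrite !uderiv_iota mactDr iD.
- by rewrite !uderiv_scal addr0.
- by rewrite !uderivD IH IH' addrACA.
- by rewrite !uderivM IH IH' mulrDl mulrDr addrACA.
Qed.

Lemma uderivZr X c u : uderiv X (c *: u) = c *: uderiv X u.
Proof.
elim/env_ind: X => [x|d|X Y IH IH'|X Y IH IH'].
- by rewrite !uderiv_iota mactZr iZ.
- by rewrite !uderiv_scal scaler0.
- by rewrite !uderivD IH IH' scalerDr.
- by rewrite !uderivM IH IH' -scalerAl -scalerAr scalerDr.
Qed.

Lemma uderiv_lie X u v :
  uderiv X (lie u v) = uderiv (uderiv X u) v - uderiv (uderiv X v) u.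
Proof.
have dB Y Z w : uderiv (Y - Z) w = uderiv Y w - uderiv Z w.
  by rewrite -scaleN1r uderivD uderivZ scaleN1r.
elim/env_ind: X => [x|d|X Y IH IH'|X Y IH IH'].
- by rewrite !uderiv_iota mact_lie iD -[- _ in LHS]scaleN1r iZ scaleN1r.
- by rewrite !uderiv_scal -(scale0r 1) !uderiv_scal scale0r subr0.
- by rewrite !uderivD IH IH' opprD addrACA.
- rewrite !uderivM !uderivD !uderivM IH IH' mulrBl mulrBr.
  set p := _ * Y; set q := uderiv X u * _; set r := uderiv X v * _.
  set p' := _ * Y; set s := X * _; set s' := X * _.
  rewrite !opprD [- p' - r + _]addrACA [RHS]addrACA [p + q + _]addrACA.
  by rewrite [r + s + _]addrACA !subrr addr0 add0r.
Qed.

Lemma eactD X Y s : eact (X + Y) s = eact X s + eact Y s.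
Proof.
elim: s X Y => [u|c|s IHs t IHt|s IHs t IHt] X Y /=.
- exact: uderivD.
- exact: scalerDr.
- by rewrite IHs IHt addrACA.
- by rewrite IHs IHt.
Qed.

Lemma eactZ c X s : eact (c *: X) s = c *: eact X s.
Proof.
elim: s X => [u|d|s IHs t IHt|s IHs t IHt] X /=.
- exact: uderivZ.
- by rewrite !scalerA mulrC.
- by rewrite IHs IHt scalerDr.
- by rewrite IHs IHt.
Qed.

Lemma eact_rel X s t : erel s t -> eact X s = eact X t.
Proof.
move=> st; elim: st X => {s t} //=.
- by move=> s t r _ IH _ IH' X; rewrite IH IH'.
- by move=> s s' t t' _ IH _ IH' X; rewrite IH IH'.
- by move=> s s' t t' _ IH _ IH' X; rewrite IH IH'.
- by move=> s t r X; rewrite addrA.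
- by move=> s t X; rewrite addrC.
- by move=> s X; rewrite scale0r add0r.
- by move=> s X; rewrite eactZ scaleN1r addNr scale0r.
- by move=> s X; rewrite scale1r.
- by move=> s X; rewrite scale1r.
- by move=> s t r X; rewrite eactD.
- by move=> c d X; rewrite scalerDl.
- by move=> c d X; rewrite scalerA mulrC.
- by move=> c s X; rewrite eactZ.
- by move=> u v X; rewrite uderivDr.
- by move=> c u X; rewrite uderivZr uderivZ.
- by move=> u v X; rewrite uderiv_lie !uderivZ scaleN1r.
Qed.

Lemma uact_pi X s : uact X (epi s) = eact X s.
Proof. by apply: eact_rel; apply: erel_repr. Qed.

Lemma uact_bilinear : bilinear_map uact.
Proof.
split=> [X Y A|X A B|c X A|c X A].
- exact: eactD.
- elim/env_piW: A => s; elim/env_piW: B => t.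
  by rewrite -epiD !uact_pi.
- exact: eactZ.
- elim/env_piW: A => s.
  rewrite -[epi s in LHS]mul1r scalerAl -epi_scal -epiM !uact_pi /=.
  exact: eactZ.
Qed.

Lemma uactM X A B : uact X (A * B) = uact (uact X A) B.
Proof.
elim/env_piW: A => s; elim/env_piW: B => t.
by rewrite -epiM !uact_pi.
Qed.

Lemma uact1 X : uact X 1 = X.
Proof. by rewrite -[1 in LHS]scale1r -epi_scal uact_pi /= scale1r. Qed.

Lemma uact_der X Y u :
  uact (X * Y) (uiota u) = uact X (uiota u) * Y + X * uact Y (uiota u).
Proof. by rewrite !uact_pi /=; apply: uderivM. Qed.

Lemma uact_iota x u : uact (uiota x) (uiota u) = uiota (M x u).
Proof. by rewrite uact_pi /= uderiv_iota. Qed.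

End Action.

Section HopfOperators.
Variables (K : fieldType) (g a : lieAlgType K) (M : rLieModule g a).
Local Notation Ug := (env g).
Local Notation Ua := (env a).
Local Notation "X <| A" := (uact M X A) (at level 40, left associativity).

Record hopf_O_operator (T : {linear Ug -> Ua}) : Prop := HopfOOperator {
  hopf_O_coprod : forall f,
    coprod (T f) = sweedler f (fun f1 f2 => T f1 *t T f2);
  hopf_O_counit : forall f, counit (T f) = counit f;
  hopf_O_mul : forall e f,
    T e * T f = T (sweedler f (fun f1 f2 => (e <| T f1) * f2))
}.

Lemma hopf_O_coprod_bilinear (T : {linear Ug -> Ua}) :
  bilinear_map (fun f1 f2 => T f1 *t T f2).
Proof.
by split=> *; rewrite ?linearD ?linearZ /= ?tensDl ?tensDr ?tensZl ?tensZr.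
Qed.

Lemma hopf_O_mul_bilinear (T : {linear Ug -> Ua}) (e : Ug) :
  bilinear_map (fun f1 f2 => (e <| T f1) * f2).
Proof.
have [_ aD _ aZ] := uact_bilinear M.
split=> *.
- by rewrite linearD aD mulrDl.
- by rewrite mulrDr.
- by rewrite linearZ /= aZ -scalerAl.
- by rewrite scalerAr.
Qed.

Definition sharp (A B : {linear Ug -> Ua}) (f : Ug) : Ua :=
  sweedler f (fun f1 f2 =>
    sweedler (B f2) (fun b1 b2 => A (f1 <| antipode b1) * b2)).

Definition sharp_unit (f : Ug) : Ua := (counit f)%:A.

Lemma sharp_inner_bilinear (A : {linear Ug -> Ua}) (f1 : Ug) :
  bilinear_map (fun b1 b2 => A (f1 <| antipode b1) * b2).
Proof.
have [_ aD _ aZ] := uact_bilinear M.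
split=> *.
- by rewrite !linearD aD linearD mulrDl.
- by rewrite mulrDr.
- by rewrite !linearZ /= aZ linearZ -scalerAl.
- by rewrite scalerAr.
Qed.

Lemma sharp_outer_bilinear (A B : {linear Ug -> Ua}) :
  bilinear_map (fun f1 f2 =>
    sweedler (B f2) (fun b1 b2 => A (f1 <| antipode b1) * b2)).
Proof.
have [aD _ aZ _] := uact_bilinear M.
split=> [v v' w|v w w'|c v w|c v w].
- rewrite /sweedler -tlift_add; apply: eq_tlift => b1 b2 /=.
  by rewrite aD linearD mulrDl.
- by rewrite linearD /sweedler coprodD tliftD //; apply: sharp_inner_bilinear.
- rewrite /sweedler -tlift_scale; apply: eq_tlift => b1 b2 /=.
  by rewrite aZ linearZ -scalerAl.
- by rewrite linearZ /sweedler coprodZ tliftZ //; apply: sharp_inner_bilinear.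
Qed.

Fact sharp_linear (A B : {linear Ug -> Ua}) : linear (sharp A B).
Proof. exact/sweedler_linear/sharp_outer_bilinear. Qed.

HB.instance Definition _ (A B : {linear Ug -> Ua}) :=
  GRing.isLinear.Build K Ug Ua *:%R (sharp A B) (sharp_linear A B).

Definition sharp_inverse (A B : {linear Ug -> Ua}) : Prop :=
  sharp A B =1 sharp_unit /\ sharp B A =1 sharp_unit.

End HopfOperators.

(* Main.v *)
(* For linear endomorphisms P, Q of U(g) such that P commutes with the action
   and Q is a coalgebra map, the O-operator identity and coassociativity give
     ((T o P) # (T o Q))(f)
       = T(((P(f_(1)) <| S(T(Q f_(2)))) <| T(Q f_(3))) Q(f_(4)))
       = T(P(f_(1)) Q(f_(2))),
   because S(T(Q f_(2))) T(Q f_(3)) collapses to a counit.  Taking (P, Q) to be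
   (id, S) and (S, id), the antipode axioms of U(g) leave counit(f) T(1), and
   T(1) = 1 because T(1) is group-like, hence invertible, and idempotent. *)
Require Import Defs.
From HB Require Import structures.
From mathcomp Require Import all_boot all_order all_algebra.

Set Implicit Arguments.
Unset Strict Implicit.
Unset Printing Implicit Defensive.

Import GRing.Theory.
Local Open Scope ring_scope.

(** * Interchange and composition of lifts from tensor products *)

Section TensorLiftTheory.
Variables (K : fieldType) (V W V' W' Z Z' : lmodType K).

(* [tlift] is linear in the map being lifted even when that map is not
   bilinear, so the interchange of two lifts needs no hypothesis. *)
Lemma tlift_exchange (F : V -> W -> V' -> W' -> Z) s t :
  tlift (fun v w => tlift (F v w) t) s =
  tlift (fun v' w' => tlift (fun v w => F v w v' w') s) t.
Proof.
rewrite {1}/tlift [in RHS](eq_tlift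
  (b' := fun v' w' => teval (fun v w => F v w v' w') (trepr s))) //.
elim: (trepr s) => [|v w|r IHr r' IHr'|c r IHr] //=.
(* The zero term of [s] leaves the lift over [t] of the zero map, which vanishes by recursion on a
   representative of [t]. *)
- rewrite /tlift; elim: (trepr t) => [|v' w'|p IHp q IHq|c p IHp] //=.
  + by rewrite -IHp -IHq addr0.
  + by rewrite -IHp scaler0.
- by rewrite IHr IHr' tlift_add.
- by rewrite IHr tlift_scale.
Qed.

Lemma linear_tlift (L : {linear Z -> Z'}) (b : V -> W -> Z) s :
  L (tlift b s) = tlift (fun v w => L (b v w)) s.
Proof.
rewrite /tlift; elim: (trepr s) => [|v w|r IHr r' IHr'|c r IHr] //=.
- exact: linear0.
- by rewrite linearD IHr IHr'.
- by rewrite linearZ /= IHr.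
Qed.

(** Supplies the bilinearity side conditions of nested Sweedler sums, whose outer legs enter the
    inner sum as parameters. *)
Lemma tlift_parametric_bilinear (F : V' -> W' -> V -> W -> Z) s :
  (forall v w, bilinear_map (fun v' w' => F v' w' v w)) ->
  bilinear_map (fun v' w' => tlift (F v' w') s).
Proof.
move=> bF; split=> *; rewrite -?tlift_add -?tlift_scale;
  apply: eq_tlift => v w; have [FDl FDr FZl FZr] := bF v w.
- exact: FDl.
- exact: FDr.
- exact: FZl.
- exact: FZr.
Qed.

End TensorLiftTheory.

(** Bilinearity of [E] matters because [tlift b s] is a tensor whose chosen representative is
    unrelated to that of [s]. *)
Lemma tlift_comp (K : fieldType) (V W V' W' Z : lmodType K)
    (E : V' -> W' -> Z) (b : V -> W -> tensor V' W') s :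
  bilinear_map E -> tlift E (tlift b s) = tlift (fun v w => tlift E (b v w)) s.
Proof.
move=> bE; rewrite {2 3}/tlift.
elim: (trepr s) => [|v w|r IHr r' IHr'|c r IHr] //=.
- exact: tlift0.
- by rewrite tliftD // IHr IHr'.
- by rewrite tliftZ // IHr.
Qed.

Lemma bilinear_map_comp (K : fieldType) (V W V' W' Z : lmodType K)
    (L : {linear V' -> V}) (L' : {linear W' -> W}) (E : V -> W -> Z) :
  bilinear_map E -> bilinear_map (fun x y => E (L x) (L' y)).
Proof. by case=> *; split=> *; rewrite ?linearD ?linearZ /=. Qed.

(** * Sweedler sums over enveloping algebras *)

Lemma sweedler_exchange (K : fieldType) (g h : lieAlgType K) (Z : lmodType K)
    (F : env g -> env g -> env h -> env h -> Z) s t :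
  sweedler s (fun s1 s2 => sweedler t (F s1 s2)) =
  sweedler t (fun t1 t2 => sweedler s (fun s1 s2 => F s1 s2 t1 t2)).
Proof. exact: tlift_exchange. Qed.

Section Sweedler.
Variables (K : fieldType) (g : lieAlgType K).
Local Notation U := (env g).

Section Values.
Variables (Z : lmodType K) (E : U -> U -> Z).

Lemma eq_sweedler (E' : U -> U -> Z) f :
  (forall x y, E x y = E' x y) -> sweedler f E = sweedler f E'.
Proof. by move=> EE'; apply: eq_tlift. Qed.

Hypothesis bE : bilinear_map E.

Lemma sweedlerD s t : sweedler (s + t) E = sweedler s E + sweedler t E.
Proof. by rewrite /sweedler coprodD tliftD. Qed.

Lemma sweedlerZ c s : sweedler (c *: s) E = c *: sweedler s E.
Proof. by rewrite /sweedler coprodZ tliftZ. Qed.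

Lemma sweedler1 : sweedler 1 E = E 1 1.
Proof. by rewrite /sweedler coprod1 tlift_tens. Qed.

Lemma sweedler_iota x : sweedler (uiota x) E = E (uiota x) 1 + E 1 (uiota x).
Proof. by rewrite /sweedler coprod_iota tliftD // !tlift_tens. Qed.

(** The coproduct is multiplicative, and the product of two tensors is a double lift through which
    [E] passes. *)
Lemma sweedlerM s t :
  sweedler (s * t) E =
  sweedler s (fun s1 s2 => sweedler t (fun t1 t2 => E (s1 * t1) (s2 * t2))).
Proof.
rewrite /sweedler coprodM [coprod s * coprod t]/(tmul _ _) /tmul.
rewrite tlift_comp //; apply: eq_tlift => s1 s2.
rewrite tlift_comp //; apply: eq_tlift => t1 t2.
exact: tlift_tens.
Qed.

End Values.

Lemma linear_sweedler (Z Z' : lmodType K) (L : {linear Z -> Z'})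
    (E : U -> U -> Z) f :
  L (sweedler f E) = sweedler f (fun x y => L (E x y)).
Proof. exact: linear_tlift. Qed.

(** * Coassociativity of the coproduct *)

Section Coassociativity.
Variable Z : lmodType K.
Implicit Types E : U -> U -> U -> Z.

(** The arguments are paired to match the two bracketings of an iterated coproduct. *)
Definition trilinear_map E :=
  (forall z, bilinear_map (fun x y => E x y z)) /\
  (forall x, bilinear_map (E x)).

Lemma sweedler_bilinearl E : trilinear_map E ->
  bilinear_map (fun u z => sweedler u (fun x y => E x y z)).
Proof.
move=> [bl br]; split=> *; rewrite ?sweedlerD ?sweedlerZ //;
  rewrite /sweedler -?tlift_add -?tlift_scale;
  apply: eq_tlift => x y; first exact: bilinDr.
exact: bilinZr.
Qed.

Lemma sweedler_bilinearr E : trilinear_map E ->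
  bilinear_map (fun x u => sweedler u (E x)).
Proof.
move=> [bl br]; split=> *; rewrite ?sweedlerD ?sweedlerZ //;
  rewrite /sweedler -?tlift_add -?tlift_scale;
  apply: eq_tlift => y z.
- exact: (bilinDl (bl z)).
- exact: (bilinZl (bl z)).
Qed.

Lemma trilinear_mul E a b c : trilinear_map E ->
  trilinear_map (fun x y z => E (a * x) (b * y) (c * z)).
Proof.
move=> [bl br]; split=> [z|x].
- by have [? ? ? ?] := bl (c * z); split=> *; rewrite ?mulrDr -?scalerAr.
- by have [? ? ? ?] := br (a * x); split=> *; rewrite ?mulrDr -?scalerAr.
Qed.

Lemma trilinear_mulr E a b c : trilinear_map E ->
  trilinear_map (fun x y z => E (x * a) (y * b) (z * c)).
Proof.
move=> [bl br]; split=> [z|x].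
- by have [? ? ? ?] := bl (z * c); split=> *; rewrite ?mulrDl -?scalerAl.
- by have [? ? ? ?] := br (x * a); split=> *; rewrite ?mulrDl -?scalerAl.
Qed.

(** Induction on [f] for all [E] at once, since in the product case the hypotheses are applied to
    maps other than [E]. *)
Lemma sweedler_coassoc E f : trilinear_map E ->
  sweedler f (fun u z => sweedler u (fun x y => E x y z)) =
  sweedler f (fun x u => sweedler u (E x)).
Proof.
elim/env_ind: f E => [x|c|s t IHs IHt|s t IHs IHt] E tE;
  have bL := sweedler_bilinearl tE; have bR := sweedler_bilinearr tE;
  have [bl br] := tE.
- rewrite !sweedler_iota // !sweedler1 // addrA; congr (_ + _).
- by rewrite !sweedlerZ // !sweedler1 // !sweedler1.
- by rewrite !sweedlerD // IHs // IHt.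
(* [G] is [E] with the legs of [t] already summed, bracketed to the right. The hypothesis on [t], at
   translates of [E], makes [G] appear; the hypothesis on [s] then applies to [G]. *)
- pose G x y z := sweedler t (fun t1 u => sweedler u
    (fun t2 t3 => E (x * t1) (y * t2) (z * t3))).
  have tG : trilinear_map G.
    split=> [z|x]; apply: tlift_parametric_bilinear => t1 u;
      apply: tlift_parametric_bilinear => t2 t3;
      by have [bl' br'] := trilinear_mulr t1 t2 t3 tE.
  rewrite !sweedlerM //.
  transitivity (sweedler s (fun u z => sweedler u (fun x y => G x y z))).
    apply: eq_sweedler => s1 s2.
    transitivity (sweedler t (fun t1 t2 => sweedler s1 (fun a b =>
        sweedler t1 (fun c d => E (a * c) (b * d) (s2 * t2))))).
      by apply: eq_sweedler => t1 t2; rewrite sweedlerM.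
    rewrite sweedler_exchange; apply: eq_sweedler => a b.
    exact: IHt (trilinear_mul a b s2 tE).
  rewrite IHs //; apply: eq_sweedler => s1 s2.
  rewrite sweedler_exchange; apply: eq_sweedler => t1 t2.
  by rewrite sweedlerM.
Qed.

End Coassociativity.

(** * Counit and antipode axioms *)

Lemma scale_sweedler (Z : lmodType K) c (E : U -> U -> Z) f :
  c *: sweedler f E = sweedler f (fun x y => c *: E x y).
Proof. by rewrite [RHS]tlift_scale. Qed.

Lemma mulr_sweedler (A : algType K) (z : A) E (f : U) :
  z * sweedler f E = sweedler f (fun x y => z * E x y).
Proof. exact: (linear_tlift (z \*o idfun)). Qed.

Lemma sweedler_mulr (A : algType K) (z : A) E (f : U) :
  sweedler f E * z = sweedler f (fun x y => E x y * z).
Proof. exact: (linear_tlift (z \o* idfun)). Qed.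

Lemma sweedler_counitl (f : U) : sweedler f (fun x y => counit x *: y) = f.
Proof.
have bil : bilinear_map (fun x y : U => counit x *: y).
  by split=> *; rewrite ?counitD ?counitZ ?scalerDl ?scalerDr ?scalerA // mulrC.
elim/env_ind: f => [x|c|s t IHs IHt|s t IHs IHt].
- by rewrite sweedler_iota // counit_iota counit1 scale0r add0r scale1r.
- by rewrite sweedlerZ // sweedler1 // counit1 scale1r.
- by rewrite sweedlerD // IHs IHt.
- rewrite sweedlerM // -[in RHS]IHs -[in RHS]IHt sweedler_mulr.
  apply: eq_sweedler => s1 s2; rewrite mulr_sweedler.
  apply: eq_sweedler => t1 t2.
  by rewrite counitM -scalerAl -scalerAr scalerA.
Qed.

Lemma counit_scal c : counit (c%:A : U) = c.
Proof. by rewrite counitZ counit1 mulr1. Qed.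

Lemma antipodeD (s t : U) : antipode (s + t) = antipode s + antipode t.
Proof. exact: linearD. Qed.

Lemma antipodeZ c (s : U) : antipode (c *: s) = c *: antipode s.
Proof. exact: linearZ. Qed.

Lemma counit_antipode (f : U) : counit (antipode f) = counit f.
Proof.
elim/env_ind: f => [x|c|s t IHs IHt|s t IHs IHt].
- by rewrite antipode_iota -scaleN1r counitZ counit_iota mulr0.
- by rewrite antipodeZ antipode1.
- by rewrite antipodeD !counitD IHs IHt.
- by rewrite antipodeM !counitM IHs IHt mulrC.
Qed.

(* The antipode reverses coproducts in general; by cocommutativity of U(g) it
   also preserves them. *)
Lemma sweedler_antipode (Z : lmodType K) (E : U -> U -> Z) f :
  bilinear_map E ->
  sweedler (antipode f) E = sweedler f (fun x y => E (antipode x) (antipode y)).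
Proof.
elim/env_ind: f E => [x|c|s t IHs IHt|s t IHs IHt] E bE;
  have bES := bilinear_map_comp (@antipode K g) (@antipode K g) bE.
- rewrite antipode_iota -scaleN1r sweedlerZ // !sweedler_iota //.
  rewrite antipode_iota antipode1 -scaleN1r.
  by rewrite (bilinZl bE) (bilinZr bE) scalerDr.
- by rewrite antipodeZ antipode1 !sweedlerZ // !sweedler1 // antipode1.
- by rewrite antipodeD !sweedlerD // IHs // IHt.
- rewrite antipodeM !sweedlerM // IHt; last first.
    apply: tlift_parametric_bilinear => s1 s2.
    by case: bE => *; split=> *; rewrite ?mulrDl -?scalerAl.
  rewrite [RHS]sweedler_exchange; apply: eq_sweedler => t1 t2.
  rewrite IHs; last first.
    by case: bE => *; split=> *; rewrite ?mulrDr -?scalerAr.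
  by apply: eq_sweedler => s1 s2; rewrite !antipodeM.
Qed.

Lemma antipode_mul_bilinear : bilinear_map (fun x y : U => antipode x * y).
Proof.
by split=> *;
  rewrite ?antipodeD ?antipodeZ ?mulrDl ?mulrDr -?scalerAl -?scalerAr.
Qed.

(** On a product the summand is S(t_(1)) (S(s_(1)) s_(2)) t_(2), so the sum over [s] collapses to a
    scalar first. *)
Lemma sweedler_antipodel (f : U) :
  sweedler f (fun x y => antipode x * y) = (counit f)%:A.
Proof.
have bil := antipode_mul_bilinear.
elim/env_ind: f => [x|c|s t IHs IHt|s t IHs IHt].
- rewrite sweedler_iota // counit_iota antipode_iota antipode1.
  by rewrite mulr1 mul1r addNr scale0r.
- by rewrite sweedlerZ // sweedler1 // antipode1 mulr1 counit_scal.
- by rewrite sweedlerD // IHs IHt counitD scalerDl.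
- rewrite sweedlerM // sweedler_exchange.
  transitivity (sweedler t (fun t1 t2 => counit s *: (antipode t1 * t2))).
    apply: eq_sweedler => t1 t2.
    rewrite -[t2 in RHS]mul1r scalerAr scalerAl -IHs.
    rewrite sweedler_mulr mulr_sweedler.
    by apply: eq_sweedler => s1 s2; rewrite antipodeM !mulrA.
  by rewrite -scale_sweedler IHt scalerA counitM.
Qed.

(** On a product the summand is s_(1) (t_(1) S(t_(2))) S(s_(2)), so now the sum over [t] collapses
    first. *)
Lemma sweedler_antipoder (f : U) :
  sweedler f (fun x y => x * antipode y) = (counit f)%:A.
Proof.
have bil : bilinear_map (fun x y : U => x * antipode y).
  by split=> *;
    rewrite ?antipodeD ?antipodeZ ?mulrDl ?mulrDr -?scalerAl -?scalerAr.
elim/env_ind: f => [x|c|s t IHs IHt|s t IHs IHt].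
- rewrite sweedler_iota // counit_iota antipode_iota antipode1.
  by rewrite mulr1 mul1r addrN scale0r.
- by rewrite sweedlerZ // sweedler1 // antipode1 mulr1 counit_scal.
- by rewrite sweedlerD // IHs IHt counitD scalerDl.
- rewrite sweedlerM //.
  transitivity (sweedler s (fun s1 s2 => counit t *: (s1 * antipode s2))).
    apply: eq_sweedler => s1 s2.
    rewrite -[s1 in RHS]mulr1 scalerAl scalerAr -IHt.
    rewrite mulr_sweedler sweedler_mulr.
    by apply: eq_sweedler => t1 t2; rewrite antipodeM !mulrA.
  by rewrite -scale_sweedler IHs scalerA counitM mulrC.
Qed.

End Sweedler.

(** * The action, Hopf O-operators and the product [sharp] *)

Section HopfOperatorTheory.
Variables (K : fieldType) (g a : lieAlgType K) (M : rLieModule g a).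
Local Notation Ug := (env g).
Local Notation Ua := (env a).
Local Notation "X <| A" := (uact M X A) (at level 40, left associativity).

(** The Leibniz rule at 1 * 1 shows that every generator of U(a) kills 1. *)
Lemma uact1l (A : Ua) : 1 <| A = counit A *: 1.
Proof.
have [aDl aDr aZl aZr] := uact_bilinear M.
elim/env_ind: A => [u|c|s t IHs IHt|s t IHs IHt].
- have := uact_der M 1 1 u; rewrite !mul1r mulr1 counit_iota scale0r => /eqP.
  by rewrite -subr_eq subrr eq_sym => /eqP.
- by rewrite aZr uact1 counit_scal.
- by rewrite aDr IHs IHt counitD scalerDl.
- by rewrite uactM IHs aZl IHt scalerA counitM.
Qed.

Lemma uact_sweedler (h : lieAlgType K) X (E : env h -> env h -> Ua) f :
  X <| sweedler f E = sweedler f (fun x y => X <| E x y).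
Proof.
have [_ aDr _ aZr] := uact_bilinear M.
have lin : linear (uact M X) by move=> c s t; rewrite aDr aZr.
pose L : {linear Ua -> Ug} :=
  HB.pack (uact M X) (GRing.isLinear.Build K Ua Ug *:%R (uact M X) lin).
exact: (linear_sweedler L).
Qed.

(** For a generator of U(a), both sides agree on generators of U(g), and the Leibniz rule survives
    the reversal of products with its two terms swapped. *)
Lemma antipode_uact (X : Ug) (A : Ua) : antipode (X <| A) = antipode X <| A.
Proof.
have [aDl aDr aZl aZr] := uact_bilinear M.
elim/env_ind: A X => [u|c|s t IHs IHt|s t IHs IHt] X.
- elim/env_ind: X => [x|c|X Y IHX IHY|X Y IHX IHY].
  + by rewrite uact_iota !antipode_iota -scaleN1r aZl uact_iota scaleN1r.
  + by rewrite aZl !antipodeZ antipode1 aZl uact1l antipodeZ antipode1.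
  + by rewrite aDl !antipodeD aDl IHX IHY.
  + by rewrite uact_der antipodeD !antipodeM uact_der IHX IHY addrC.
- by rewrite !aZr !uact1 antipodeZ.
- by rewrite !aDr antipodeD IHs IHt.
- by rewrite !uactM IHt IHs.
Qed.

Variables (T : {linear Ug -> Ua}) (hT : hopf_O_operator M T).

Lemma hopf_O_operator1 : T 1 = 1.
Proof.
have Tgrp : coprod (T 1) = T 1 *t T 1.
  by rewrite (hopf_O_coprod hT) sweedler1 //; apply: hopf_O_coprod_bilinear.
(* The O-operator identity at e = f = 1, where [T 1] acts on 1 by its counit. *)
have Tidem : T 1 * T 1 = T 1.
  rewrite (hopf_O_mul hT) sweedler1; last exact: hopf_O_mul_bilinear.
  by rewrite mulr1 uact1l (hopf_O_counit hT) counit1 scale1r.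
(* As [T 1] is group-like, the left antipode axiom at [T 1] has this single product as its sum. *)
have Tinv : antipode (T 1) * T 1 = 1.
  rewrite -(tlift_tens (antipode_mul_bilinear a)) -Tgrp [LHS]sweedler_antipodel.
  by rewrite (hopf_O_counit hT) counit1 scale1r.
by rewrite -[LHS]mul1r -Tinv -mulrA Tidem.
Qed.

Lemma sweedler_hopf_O (Z : lmodType K) (E : Ua -> Ua -> Z) f :
  bilinear_map E ->
  sweedler (T f) E = sweedler f (fun x y => E (T x) (T y)).
Proof.
move=> bE; rewrite {1}/sweedler (hopf_O_coprod hT) /sweedler.
rewrite tlift_comp //; apply: eq_tlift => x y; exact: tlift_tens.
Qed.

(** Pointwise equality with the composites lets [T] itself stand for [T \o idfun]. *)
Lemma sharp_comp (P Q : {linear Ug -> Ug}) (A B : {linear Ug -> Ua}) f :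
  (forall X u, P (X <| u) = P X <| u) ->
  (forall X, counit (Q X) = counit X) ->
  (forall (Z : lmodType K) (E : Ug -> Ug -> Z) X, bilinear_map E ->
    sweedler (Q X) E = sweedler X (fun x y => E (Q x) (Q y))) ->
  A =1 T \o P -> B =1 T \o Q ->
  sharp M A B f = T (sweedler f (fun x y => P x * Q y)).
Proof.
move=> Pact Qcounit Qcoprod AE BE.
have [aDl aDr aZl aZr] := uact_bilinear M.
rewrite linear_sweedler; apply: eq_sweedler => x y.
rewrite BE /= sweedler_hopf_O; last exact: sharp_inner_bilinear.
rewrite Qcoprod; last first.
  exact: bilinear_map_comp (sharp_inner_bilinear M A x).
(* The legs f_(2), f_(3), f_(4) are [u], [v], [w], and [x] is f_(1); two successive actions are
   merged into one by a product. *)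
pose F u v w := (P x <| (antipode (T (Q u)) * T (Q v))) * Q w.
have tF : trilinear_map F.
  by split=> z; split=> *; rewrite /F ?(linearD, linearZ) /= ?mulrDl ?mulrDr
    -?scalerAl -?scalerAr ?aDr ?aZr ?mulrDl ?mulrDr -?scalerAl -?scalerAr.
transitivity (T (sweedler y (fun u z => sweedler z (F u)))).
  rewrite linear_sweedler; apply: eq_sweedler => u z.
  rewrite AE /= Pact (hopf_O_mul hT) Qcoprod; last exact: hopf_O_mul_bilinear.
  by congr (T _); apply: eq_sweedler => v w; rewrite -uactM.
(* Regroup so that [u] and [v] are the two legs of one element; on the right, the counit axiom
   expands [y] to match. *)
rewrite -sweedler_coassoc //; congr (T _).
rewrite -[y in RHS]sweedler_counitl linear_sweedler mulr_sweedler.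
apply: eq_sweedler => u w; rewrite -sweedler_mulr linearZ -scalerAr scalerAl.
congr (_ * _); have bS := antipode_mul_bilinear a.
(* Since T o Q is a coalgebra map, the inner sum is the left antipode sum at [T (Q u)]. *)
transitivity (P x <| sweedler (T (Q u)) (fun b c => antipode b * c)).
  rewrite sweedler_hopf_O // Qcoprod; first by rewrite uact_sweedler.
  exact: (bilinear_map_comp T T bS).
by rewrite sweedler_antipodel (hopf_O_counit hT) Qcounit aZr uact1.
Qed.

End HopfOperatorTheory.

Theorem proposition4p1p10 (K : fieldType) (char0 : [pchar K] =i pred0)
    (g a : lieAlgType K) (M : rLieModule g a)
    (T : {linear env g -> env a}) (hT : hopf_O_operator M T) :
  sharp_inverse M T (T \o @antipode K g : {linear env g -> env a}).
Proof.
split=> f.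
- rewrite (sharp_comp hT (P := idfun) (Q := @antipode K g)) //.
  + by rewrite sweedler_antipoder linearZ /= (hopf_O_operator1 hT).
  + exact: counit_antipode.
  + exact: sweedler_antipode.
- rewrite (sharp_comp hT (P := @antipode K g) (Q := idfun)) //.
  + by rewrite sweedler_antipodel linearZ /= (hopf_O_operator1 hT).
  + exact: antipode_uact.
Qed.
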